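(* Let $\theta,\alpha$ be elements of the algebraic closure $\overline K$ of a valued field $(K,v)$ with respective minimal polynomials $f,\phi$ over $K$. Suppose that $\deg f>\deg\phi$. Then $(\theta,\alpha)$ is a $(K,v)$-distinguished pair if and only if for $\delta=\bar v(\theta-\alpha)$, $(\alpha,\delta)$ is a $(K,v)$-minimal pair and $f\in\mathrm{KP}(w)$, where $w=w_{\alpha,\delta}$.
   Context: $(K,v)$ is a valued field of arbitrary rank, $\overline K$ a fixed algebraic closure, $\bar v$ a fixed extension of $v$ to $\overline K$. For $\alpha\in\overline K$, $\deg\alpha=[K(\alpha):K]$. For $(\alpha,\delta)\in\overline K\times\Gamma_{\bar v}$, $\overline w_{\alpha,\delta}$ is the valuation on $\overline K[x]$ given by $\overline w_{\alpha,\delta}\big(\sum c_i(x-\alpha)^i\big)=\min_i\{\bar v(c_i)+i\delta\}$, $c_i\in\overline K$, and $w_{\alpha,\delta}$ is its restriction to $K[x]$. The pair $(\alpha,\delta)$ is a $(K,v)$-minimal pair if $\deg\beta\ge\deg\alpha$ for every $\beta\in\overline K$ with $\bar v(\alpha-\beta)\ge\delta$. $(\theta,\alpha)\in\overline K^2$ is a $(K,v)$-distinguished pair if: $\deg\theta>\deg\alpha$; $\bar v(\theta-\alpha)=\max\{\bar v(\theta-\beta):\beta\in\overline K,\ \deg\beta<\deg\theta\}$; and $\bar v(\theta-\eta)<\bar v(\theta-\alpha)$ for every $\eta\in\overline K$ with $\deg\eta<\deg\alpha$. Key polynomials: $f\sim_w g$ means $w(f-g)>w(f)=w(g)$; $f\mid_w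 g$ means $g\sim_w fh$ for some $h\in K[x]$. A monic $f\in K[x]$ is a key polynomial for $w$ if $f\mid_w gh$ implies $f\mid_w g$ or $f\mid_w h$, and for every nonzero $g$, $f\mid_w g$ implies $\deg g\ge\deg f$. $\mathrm{KP}(w)$ is the set of key polynomials for $w$. *)

(* Defs.v *)
From HB Require Import structures.
From mathcomp Require Import all_boot all_order all_algebra.
From mathcomp Require Import classical_sets.

Set Implicit Arguments.
Unset Strict Implicit.
Unset Printing Implicit Defensive.
Import Order.TTheory GRing.Theory.
Local Open Scope ring_scope.

(* Totally ordered abelian groups; no archimedean assumption, so that
   valuations of arbitrary rank are covered. *)
HB.mixin Record POrderedZmodule_isTotallyOrdered G of Num.POrderedZmodule G := {
  ozmod_total : total (<=%R : rel G);
  ozmod_leD2l : forall x y z : G, x <= y -> z + x <= z + y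
}.

#[short(type="orderedZmodType")]
HB.structure Definition OrderedZmodule :=
  { G of Num.POrderedZmodule G & POrderedZmodule_isTotallyOrdered G }.

HB.instance Definition _ (G : orderedZmodType) :=
  Order.POrder_isTotal.Build ring_display (OrderedZmodule.sort G) ozmod_total.

(* The extended group [G u {oo}], with [oo] absorbing and largest. *)
Definition extended (G : Type) := option G.
Definition Fin (G : Type) (g : G) : extended G := Some g.
Definition infty (G : Type) : extended G := None.
Arguments infty {G}.

HB.instance Definition _ (G : choiceType) := Choice.on (extended G).

Section Extended.
Variable G : orderedZmodType.

Definition ext_add (x y : extended G) : extended G :=
  if x is Some a then if y is Some b then Fin (a + b) else infty else infty.

Fact ext_addA : associative ext_add.
Proof. by move=> [a|] [b|] [c|] //=; rewrite addrA. Qed.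
Fact ext_addC : commutative ext_add.
Proof. by move=> [a|] [b|] //=; rewrite addrC. Qed.
Fact ext_add0 : left_id (Fin 0) ext_add.
Proof. by move=> [a|] //=; rewrite add0r. Qed.

HB.instance Definition _ :=
  GRing.isNmodule.Build (extended G) ext_addA ext_addC ext_add0.

Definition ext_le (x y : extended G) : bool :=
  if y is Some b then if x is Some a then a <= b else false else true.

Fact ext_le_refl : reflexive ext_le.
Proof. by move=> [a|] /=. Qed.
Fact ext_le_anti : antisymmetric ext_le.
Proof. by move=> [a|] [b|] //= /le_anti ->. Qed.
Fact ext_le_trans : transitive ext_le.
Proof. by move=> [a|] [b|] [c|] //=; apply: le_trans. Qed.
Fact ext_le_total : total ext_le.
Proof. by move=> [a|] [b|] //=; apply: ozmod_total. Qed.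

HB.instance Definition _ := Order.Le_isPOrder.Build ring_display (extended G)
  ext_le_refl ext_le_anti ext_le_trans.
HB.instance Definition _ :=
  Order.POrder_isTotal.Build ring_display (extended G) ext_le_total.

Fact ext_lex1 (x : extended G) : x <= infty.
Proof. by []. Qed.
HB.instance Definition _ :=
  Order.hasTop.Build ring_display (extended G) ext_lex1.

End Extended.

Record valuation (F : fieldType) (G : orderedZmodType) := Valuation {
  val_fun :> F -> extended G;
  val_eq_infty : forall x, val_fun x = infty <-> x = 0;
  val_mul : forall x y, val_fun (x * y) = val_fun x + val_fun y;
  val_add : forall x y, Order.min (val_fun x) (val_fun y) <= val_fun (x + y)
}.

Section Degree.
Variables (K : fieldType) (L : fieldType) (iota : {rmorphism K -> L}).

Definition adjoin (a : L) : set L :=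
  [set x | forall S : {pred L}, GRing.divring_closed S ->
     (forall c, iota c \in S) -> a \in S -> x \in S].

Definition is_Kbasis (V : set L) (n : nat) (b : 'I_n -> L) : Prop :=
  (forall x, V x <-> exists c : 'I_n -> K, x = \sum_i iota (c i) * b i) /\
  (forall c : 'I_n -> K, \sum_i iota (c i) * b i = 0 -> forall i, c i = 0).

(* The degree [K(a) : K]; the default value 0 is only taken when [K(a)] is not
   finite-dimensional, i.e. never for [a] algebraic over [K]. *)
Definition deg (a : L) : nat :=
  xget 0%N [set n | exists b : 'I_n -> L, is_Kbasis (adjoin a) b].

Definition is_minpoly (a : L) (p : {poly K}) : Prop :=
  [/\ p \is monic, root (map_poly iota p) a &
      forall q : {poly K}, q != 0 -> root (map_poly iota q) a ->
        (size p <= size q)%N].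

End Degree.

Section Pairs.
Variables (K L : fieldType) (iota : {rmorphism K -> L}).
Variables (G : orderedZmodType) (vbar : valuation L G).

(* The codomain [G] of [vbar] may be larger than its value group. *)
Definition minimal_pair (alpha : L) (delta : G) : Prop :=
  forall beta : L, Fin delta <= vbar (alpha - beta) ->
    (deg iota alpha <= deg iota beta)%N.

Definition is_max (A : set (extended G)) (x : extended G) : Prop :=
  A x /\ ubound A x.

Definition distinguished_pair (theta alpha : L) : Prop :=
  [/\ (deg iota alpha < deg iota theta)%N,
      is_max [set vbar (theta - beta) |
               beta in [set beta | (deg iota beta < deg iota theta)%N]]%classic
             (vbar (theta - alpha)) &
      forall eta : L, (deg iota eta < deg iota alpha)%N ->
        vbar (theta - eta) < vbar (theta - alpha)].

(* [g \Po ('X + alpha%:P)] has as coefficients those of the expansion of [g]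
   in powers of ['X - alpha%:P]. *)
Definition wbar (alpha : L) (delta : G) (g : {poly L}) : extended G :=
  let c := g \Po ('X + alpha%:P) in
  \big[Order.min/infty]_(i < size c) (vbar c`_i + Fin (delta *+ i)).

Definition wres (alpha : L) (delta : G) (g : {poly K}) : extended G :=
  wbar alpha delta (map_poly iota g).

End Pairs.

Section KeyPolynomials.
Variables (K : fieldType) (G : orderedZmodType) (w : {poly K} -> extended G).

Definition wequiv (f g : {poly K}) : Prop := w f < w (f - g) /\ w f = w g.

Definition wdvd (f g : {poly K}) : Prop := exists h : {poly K}, wequiv g (f * h).

Definition KP : set {poly K} :=
  [set f | [/\ f \is monic,
     forall g h, wdvd f (g * h) -> wdvd f g \/ wdvd f h &
     forall g, g != 0 -> wdvd f g -> (size f <= size g)%N]].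

End KeyPolynomials.

(* Main.v *)
(* Write [w] for the valuation of the pair [(alpha, delta)] and compare it with
   evaluation at [theta]. As [delta <= vbar (theta - alpha)], always
   [w g <= vbar (g theta)], and factoring [g] over the algebraic closure shows
   that the inequality is strict exactly when [g] has a root [beta] with
   [vbar (theta - beta) > delta]. Hence the maximality condition on [delta]
   says that [w g = vbar (g theta)] whenever [deg g < deg f]. This equality in
   degrees below [deg f] is equivalent to [f] being a key polynomial: if it
   holds, Euclidean division by [f] shows that [f] [w]-divides every [g] with
   [w g < vbar (g theta)]; if it fails, take [g] of least degree with
   [w g < vbar (g theta)] and divide, [f = q g + r]; then [f] [w]-divides
   [q g], although [q] and [g] both have smaller degree than [f]. *)
Require Import Defs.
From mathcomp Require Import all_boot all_order all_algebra.
From mathcomp Require Import boolp classical_sets.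
Import Order.TTheory GRing.Theory.
Local Open Scope ring_scope.

Set Implicit Arguments.
Unset Strict Implicit.
Unset Printing Implicit Defensive.

(** * Minimal polynomials and the degree of [K(a)] over [K] *)

Section Degree.
Variables (K L : fieldType) (iota : {rmorphism K -> L}).
Implicit Types (a : L) (f p : {poly K}).
Local Notation "p ^iota" := (map_poly iota p) (at level 2, format "p ^iota").

Lemma ex_minpoly a : algebraicOver iota a -> exists f, is_minpoly iota a f.
Proof.
move=> [p p_neq0 pa0].
pose P n := `[< exists q, [/\ q != 0, root q^iota a & size q = n] >].
have exP : exists n, P n by exists (size p); apply/asboolP; exists p.
case: (ex_minnP exP) => m /asboolP [q [q_neq0 qa0 <-]] q_min.
exists ((lead_coef q)^-1 *: q).
have lq_neq0 : (lead_coef q)^-1 != 0 by rewrite invr_eq0 lead_coef_eq0.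
split.
- by rewrite monicE lead_coefZ mulVf // lead_coef_eq0.
- by rewrite map_polyZ rootZ // fmorph_eq0.
- move=> r r_neq0 ra0; rewrite size_scale //.
  by apply: q_min; apply/asboolP; exists r.
Qed.

(** The gcd divides [p], so it does not vanish at [a]; its cofactor in [f] does, and minimality of
    [f] makes the gcd constant. *)
Lemma minpoly_coprime a f p : is_minpoly iota a f -> ~~ root p^iota a ->
  coprimep p f.
Proof.
move=> [f_monic fa0 f_min] pa_neq0.
have f_neq0 := monic_neq0 f_monic.
have /divpK fE := dvdp_gcdr p f.
rewrite coprimep_def; set g := gcdp p f in fE *.
have g_neq0 : g != 0 by rewrite gcdp_eq0 negb_and f_neq0 orbT.
have q_neq0 : f %/ g != 0 by apply: contraNneq f_neq0 => q0; rewrite -fE q0 mul0r.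
have ga_neq0 : ~~ root g^iota a.
  apply: contra pa_neq0 => /rootP ga0.
  by rewrite -(divpK (dvdp_gcdl p f)) rmorphM rootM ; apply/orP; right; apply/rootP.
move: fa0; rewrite -fE rmorphM rootM (negPf ga_neq0) orbF => qa0.
have := f_min _ q_neq0 qa0.
rewrite -{1}fE size_mul // -subn1 leq_subLR addnC leq_add2r.
by rewrite eqn_leq => ->; rewrite size_poly_gt0.
Qed.

Lemma adjoin_minpoly a f : is_minpoly iota a f ->
  forall x, adjoin iota a x <-> exists p, x = p^iota.[a].
Proof.
move=> fP x; split; last first.
  move=> [p ->] S S_ring SK Sa.
  have [S1 SB SV] := S_ring.
  have S0 : 0 \in S by rewrite -(subrr 1) SB.
  have SN y : y \in S -> - y \in S by move=> Sy; rewrite -sub0r SB.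
  have SD y z : y \in S -> z \in S -> y + z \in S.
    by move=> Sy Sz; rewrite -(opprK z) SB // SN.
  have SM y z : y \in S -> z \in S -> y * z \in S.
    by move=> Sy Sz; rewrite -(invrK z) SV // -(mul1r z^-1) SV.
  elim/poly_ind: p => [|p c IHp]; first by rewrite rmorph0 horner0.
  by rewrite rmorphD rmorphM /= map_polyX map_polyC !hornerE;
    apply: SD; [exact: SM | exact: SK].
pose S : {pred L} := fun x => `[< exists p, x = p^iota.[a] >].
move=> /(_ S) adjx; apply/asboolP; apply: adjx; last 2 first.
- by move=> c; apply/asboolP; exists c%:P; rewrite map_polyC hornerC.
- by apply/asboolP; exists 'X; rewrite map_polyX hornerX.
split.
- by apply/asboolP; exists 1; rewrite rmorph1 hornerC.
- move=> _ _ /asboolP [p ->] /asboolP [q ->]; apply/asboolP; exists (p - q).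
  by rewrite rmorphB !hornerE.
- move=> _ _ /asboolP [p ->] /asboolP [q ->]; apply/asboolP.
  (* Closure under division includes division by 0, where the inverse is 0 by convention. *)
  have [/rootP ->|qa_neq0] := boolP (root q^iota a).
    by exists 0; rewrite invr0 mulr0 rmorph0 horner0.
  (* Evaluated at [a], where [f] vanishes, the Bezout relation says that [u] takes there the inverse
     of the value of [q]. *)
  have /Bezout_eq1_coprimepP [[u v] /= uv1] := minpoly_coprime fP qa_neq0.
  exists (p * u); rewrite rmorphM hornerM; congr (_ * _).
  apply: (mulIf qa_neq0); rewrite mulVf //.
  have [_ /rootP fa0 _] := fP.
  move/(congr1 (fun p => p^iota.[a])): uv1.
  by rewrite rmorphD !rmorphM /= hornerD !hornerM fa0 mulr0 addr0 rmorph1 hornerC.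
Qed.

(** Writing each basis in terms of the other gives matrices with [MA *m MB = 1], by independence of
    [b]; a rank comparison concludes. *)
Lemma Kbasis_leq (V : set L) m n (b : 'I_m -> L) (b' : 'I_n -> L) :
  is_Kbasis iota V b -> is_Kbasis iota V b' -> (m <= n)%N.
Proof.
have basis_mem k (e : 'I_k -> L) i : is_Kbasis iota V e -> V (e i).
  move=> [span _]; apply/span; exists (fun j => (i == j)%:R).
  rewrite (bigD1 i) //= eqxx rmorph1 mul1r big1 ?addr0 // => j.
  by rewrite eq_sym => /negPf ->; rewrite rmorph0 mul0r.
move=> bP b'P.
have /choice [A AE] i := (b'P.1 (b i)).1 (basis_mem _ _ i bP).
have /choice [B BE] i := (bP.1 (b' i)).1 (basis_mem _ _ i b'P).
pose MA := \matrix_(i, j) A i j; pose MB := \matrix_(i, j) B i j.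
apply: (@mulmx1_min _ _ _ MA MB); apply/matrixP => i k.
apply/eqP; rewrite -subr_eq0; apply/eqP.
apply: (bP.2 (fun k => (MA *m MB) i k - 1%:M i k)).
under eq_bigr => j _ do rewrite rmorphB mulrBl.
rewrite sumrB [X in _ - X](bigD1 i) //= !mxE eqxx rmorph1 mul1r.
rewrite [X in _ - (_ + X)]big1 ?addr0; last first.
  by move=> j; rewrite mxE eq_sym => /negPf ->; rewrite rmorph0 mul0r.
apply/eqP; rewrite subr_eq0 AE; apply/eqP.
under eq_bigr => j _ do rewrite mxE rmorph_sum mulr_suml.
rewrite exchange_big; apply: eq_bigr => j _ /=.
rewrite BE mulr_sumr; apply: eq_bigr => l _.
by rewrite !mxE rmorphM mulrA.
Qed.

Lemma deg_minpoly a f : is_minpoly iota a f -> deg iota a = (size f).-1.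
Proof.
move=> fP; have [f_monic /rootP fa0 f_min] := fP.
have f_neq0 := monic_neq0 f_monic.
have sizef : size f = (size f).-1.+1 by rewrite prednK // size_poly_gt0.
have basisP : is_Kbasis iota (adjoin iota a) (fun i : 'I_(size f).-1 => a ^+ i).
  split=> [x|c c0 i].
    rewrite (adjoin_minpoly fP); split=> [[p ->]|[c ->]]; last first.
      exists (\sum_i (c i)%:P * 'X^i).
      rewrite rmorph_sum horner_sum; apply: eq_bigr => i _.
      by rewrite rmorphM /= map_polyC map_polyXn !hornerE.
    exists (fun i => (p %% f)`_i).
    rewrite {1}(divp_eq p f) rmorphD rmorphM /= hornerD hornerM fa0 mulr0 add0r.
    rewrite (@horner_coef_wide _ (size f).-1) ?size_map_poly //; last first.
      by rewrite -ltnS -sizef ltn_modp.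
    by apply: eq_bigr => j _; rewrite coef_map.
  (* A linear relation among the powers of [a] is a polynomial shorter than [f] that vanishes at
     [a]. *)
  pose q := \poly_(i < (size f).-1) (if insub i is Some j then c j else 0).
  have qE (j : 'I_(size f).-1) : q`_j = c j by rewrite coef_poly ltn_ord valK.
  rewrite -qE; suff -> : q = 0 by rewrite coef0.
  apply/eqP; apply: contraT => q_neq0.
  have : (size f <= size q)%N.
    apply: f_min => //; apply/rootP.
    rewrite (@horner_coef_wide _ (size f).-1) ?size_map_poly ?size_poly //.
    by rewrite -[RHS]c0; apply: eq_bigr => j _; rewrite coef_map qE.
  by rewrite sizef ltnNge size_poly.
(* [deg] chooses some basis length, so the length must also be shown unique. *)
apply: xget_unique; first by exists (fun i => a ^+ i).
by move=> n [b bP]; apply/eqP;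
  rewrite eqn_leq (Kbasis_leq bP basisP) (Kbasis_leq basisP bP).
Qed.

Lemma deg_root_lt a g : algebraicOver iota a -> g != 0 -> root g^iota a ->
  (deg iota a < size g)%N.
Proof.
move=> /ex_minpoly [p pP] g_neq0 ga0; rewrite (deg_minpoly pP).
have [/monic_neq0 p_neq0 _ /(_ g g_neq0 ga0)] := pP.
by case: (size p) (size_poly_gt0 p) => [|n]; rewrite ?p_neq0.
Qed.

End Degree.

(** * Order and addition in the extended group *)

Section ExtendedTheory.
Variable G : orderedZmodType.
Implicit Types (x y z t : extended G) (a b : G).

Lemma ext_add_infty x : x + infty = infty.
Proof. by case: x. Qed.

Lemma ext_add_eq_infty x y : (x + y == infty) = (x == infty) || (y == infty).
Proof. by case: x y => [a|] [b|]. Qed.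

Lemma ext_lty x : (x < infty) = (x != infty).
Proof. by rewrite lt_neqAle lex1 andbT. Qed.

Lemma ext_lt_fin x y : x < y -> x != infty.
Proof. by move=> lt_xy; rewrite -ext_lty (lt_le_trans lt_xy) ?lex1. Qed.

Lemma ext_leD x y z t : x <= y -> z <= t -> x + z <= y + t.
Proof.
move: x y z t => [a|] [b|] [c|] [d|] //= ab cd.
apply: (@le_trans _ G (a + d)); first exact: ozmod_leD2l.
by rewrite -![_ + d]addrC; apply: ozmod_leD2l.
Qed.

Lemma ext_addI z : z != infty -> injective (+%R z).
Proof. by case: z => // c _ [a|] [b|] // [] /addrI ->. Qed.

Lemma ext_leD2r z x y : z != infty -> (x + z <= y + z) = (x <= y).
Proof.
move=> z_fin; apply/idP/idP => [|le_xy]; last by rewrite ext_leD.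
case: (leP x y) => // lt_yx le_z.
have := @le_anti _ _ (x + z) (y + z).
rewrite le_z ext_leD ?(ltW lt_yx) // => /(_ isT).
rewrite ![_ + z]addrC => /(ext_addI z_fin) e.
by rewrite e ltxx in lt_yx.
Qed.

Lemma ext_ltD x y z t : x < y -> z <= t -> z != infty -> x + z < y + t.
Proof.
move=> lt_xy le_zt z_fin; apply: (@lt_le_trans _ _ (y + z)).
  by rewrite ltNge ext_leD2r // -ltNge.
by rewrite ext_leD.
Qed.

Lemma Fin_add a b : Fin (a + b) = Fin a + Fin b.
Proof. by []. Qed.

(** An ordered group has no torsion; this yields [v (-1) = 0], hence [val_opp]. *)
Lemma ext_add_self_eq0 x : x + x = 0 -> x = 0.
Proof.
move=> xx0; have [x_neg|x_pos|//] := ltgtP x 0.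
- by have := ext_ltD x_neg (ltW x_neg) (ext_lt_fin x_neg); rewrite xx0 addr0 ltxx.
- by have := ext_ltD x_pos (ltW x_pos) isT; rewrite xx0 addr0 ltxx.
Qed.

End ExtendedTheory.

(** * The strict ultrametric rule, for use with valuations of scalars and of polynomials alike *)

Section UltrametricTheory.
Variables (G : orderedZmodType) (V : zmodType) (u : V -> extended G).
Hypothesis uN : forall x, u (- x) = u x.
Hypothesis uD : forall x y, Order.min (u x) (u y) <= u (x + y).

Lemma ultra_addl x y : u x < u y -> u (x + y) = u x.
Proof.
move=> lt_xy; apply/eqP; rewrite eq_le; apply/andP; split; last first.
  by have := uD x y; rewrite min_l // ltW.
have := uD (x + y) (- y); rewrite addrK uN ge_min.
by rewrite [u y <= _]leNgt lt_xy orbF.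
Qed.
End UltrametricTheory.

(** * Elementary properties of valuations on a field *)

Section ValuationTheory.
Variables (F : fieldType) (G : orderedZmodType) (v : valuation F G).
Implicit Types (x y : F).

Lemma val_0 : v 0 = infty.
Proof. exact/val_eq_infty. Qed.

Lemma val_fin x : (v x != infty) = (x != 0).
Proof. by congr (~~ _); apply/eqP/eqP => /(val_eq_infty v x). Qed.

Lemma val_1 : v 1 = 0.
Proof.
apply: (@ext_addI _ (v 1)); first by rewrite val_fin oner_neq0.
by rewrite -val_mul mulr1 addr0.
Qed.

Lemma val_opp x : v (- x) = v x.
Proof.
rewrite -mulN1r val_mul.
by rewrite (@ext_add_self_eq0 _ (v (-1))) ?add0r // -val_mul mulrNN mulr1 val_1.
Qed.

Lemma val_subC x y : v (x - y) = v (y - x).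
Proof. by rewrite -val_opp opprB. Qed.

Lemma val_exp x n : v (x ^+ n) = v x *+ n.
Proof.
by elim: n => [|n IHn]; rewrite ?val_1 // exprS val_mul IHn mulrS.
Qed.

Lemma val_sum_ge (I : Type) (r : seq I) (P : pred I) (E : I -> F) c :
  (forall i, P i -> c <= v (E i)) -> c <= v (\sum_(i <- r | P i) E i).
Proof.
move=> cE; elim/big_rec: _ => [|i x Pi cx]; first by rewrite val_0 lex1.
by apply: le_trans (val_add _ _ _); rewrite le_min cE.
Qed.

Lemma val_sum_gt (I : Type) (r : seq I) (P : pred I) (E : I -> F) c :
  c != infty ->
  (forall i, P i -> c < v (E i)) -> c < v (\sum_(i <- r | P i) E i).
Proof.
move=> c_fin cE; elim/big_rec: _ => [|i x Pi cx]; first by rewrite val_0 ext_lty.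
by apply: lt_le_trans (val_add _ _ _); rewrite lt_min cE.
Qed.

End ValuationTheory.

(** * The Gauss valuation in which the variable has value [delta] *)

Section GaussValuation.
Variables (L : fieldType) (G : orderedZmodType) (v : valuation L G) (delta : G).
Implicit Types (c d : {poly L}) (x b : L) (m : extended G).

Definition gterm c i : extended G := v c`_i + Fin (delta *+ i).

Definition gauss c : extended G := \big[Order.min/infty]_(i < size c) gterm c i.

(** Beyond the size of [c] the term is [infty], so every index is allowed and sizes of sums and
    products need no tracking. *)
Lemma gauss_le_gterm c i : gauss c <= gterm c i.
Proof.
have [lt_ic|le_ci] := ltnP i (size c).
  exact: (bigmin_le _ (Ordinal lt_ic) (fun j : 'I_(size c) => gterm c j)).
by rewrite /gterm nth_default // val_0 lex1.
Qed.

Lemma gauss_ge m c : (forall i, m <= gterm c i) -> m <= gauss c.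
Proof. by move=> le_m; apply: le_bigmin => [|i _]; rewrite ?lex1. Qed.

Lemma gauss_attained c : c != 0 -> exists2 i, gauss c = gterm c i &
  forall j, (j < i)%N -> gauss c < gterm c j.
Proof.
move=> c_neq0.
have exi : exists i, gauss c == gterm c i.
  rewrite /gauss; case: (size c) (size_poly_gt0 c) => [|n _].
    by rewrite c_neq0.
  have [i _ ->] := @eq_bigmin _ _ _ infty ord0 xpredT
    (fun i : 'I_n.+1 => gterm c i) isT (fun i _ => ext_lex1 _).
  by exists i.
case: (ex_minnP exi) => i /eqP ci i_min; exists i => // j lt_ji.
rewrite lt_neqAle gauss_le_gterm andbT.
by apply: contraTN lt_ji => /i_min; rewrite -leqNgt.
Qed.

Lemma gauss_fin c : c != 0 -> gauss c != infty.
Proof.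
move=> c_neq0; apply: (@ext_lt_fin _ _ infty).
apply: le_lt_trans (gauss_le_gterm c (size c).-1) _.
by rewrite ext_lty ext_add_eq_infty orbF val_fin -lead_coefE lead_coef_eq0.
Qed.

Lemma gauss0 : gauss 0 = infty.
Proof. by rewrite /gauss size_poly0 big_ord0. Qed.

Lemma gaussD c d : Order.min (gauss c) (gauss d) <= gauss (c + d).
Proof.
apply: gauss_ge => i; rewrite /gterm coefD.
have [vD|vD] : v c`_i <= v (c`_i + d`_i) \/ v d`_i <= v (c`_i + d`_i).
  by have := val_add v c`_i d`_i; rewrite ge_min => /orP.
- rewrite ge_min; apply/orP; left.
  by apply: le_trans (gauss_le_gterm c i) _; rewrite ext_leD.
- rewrite ge_min; apply/orP; right.
  by apply: le_trans (gauss_le_gterm d i) _; rewrite ext_leD.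
Qed.

Lemma gaussN c : gauss (- c) = gauss c.
Proof.
rewrite /gauss size_polyN; apply: eq_bigr => i _.
by rewrite /gterm coefN val_opp.
Qed.

Lemma gterm_prod c d i j :
  v (c`_i * d`_j) + Fin (delta *+ (i + j)) = gterm c i + gterm d j.
Proof. by rewrite /gterm val_mul mulrnDr Fin_add addrACA. Qed.

(* Gauss' lemma: among the products contributing to the coefficient of index
   [i + j], with [i] and [j] the first indices where the minima are attained,
   only one has the least possible value. *)
Lemma gaussM c d : gauss (c * d) = gauss c + gauss d.
Proof.
have [->|c_neq0] := eqVneq c 0.
  by rewrite mul0r gauss0 addrC ext_add_infty.
have [->|d_neq0] := eqVneq d 0; first by rewrite mulr0 gauss0 ext_add_infty.
apply/eqP; rewrite eq_le; apply/andP; split; last first.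
  apply: gauss_ge => k; rewrite /gterm coefM.
  (* The sum is finite, so [delta *+ k] can be subtracted from it, leaving a bound on the
     coefficient alone. *)
  case cd : (gauss c + gauss d) => [g|]; last first.
    move/eqP: cd; rewrite [_ == _]ext_add_eq_infty.
    by rewrite (negPf (gauss_fin c_neq0)) (negPf (gauss_fin d_neq0)).
  have -> : Some g = Fin (g - delta *+ k) + Fin (delta *+ k).
    by rewrite -Fin_add subrK.
  rewrite ext_leD2r //; apply: val_sum_ge => i _.
  rewrite -(@ext_leD2r _ (Fin (delta *+ k))) // -Fin_add subrK.
  rewrite -[Fin g]cd -[X in delta *+ X](subnKC (leq_ord i)) gterm_prod.
  by rewrite ext_leD ?gauss_le_gterm.
have [i ci ltc] := gauss_attained c_neq0.
have [j dj ltd] := gauss_attained d_neq0.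
apply: le_trans (gauss_le_gterm _ (i + j)) _; rewrite ci dj -gterm_prod.
rewrite ext_leD2r // coefM.
have lt_i : (i < (i + j).+1)%N by rewrite ltnS leq_addr.
rewrite (bigD1 (Ordinal lt_i)) //= addKn.
have fin_ij : v (c`_i * d`_j) != infty.
  have: gauss c + gauss d != infty.
    by rewrite ext_add_eq_infty negb_or !gauss_fin.
  by rewrite ci dj -gterm_prod ext_add_eq_infty orbF.
rewrite (ultra_addl (val_opp v) (val_add v)) //.
apply: val_sum_gt => // k; rewrite -val_eqE /= => k_neq_i.
rewrite ltNge -(@ext_leD2r _ (Fin (delta *+ (i + j)))) // -ltNge.
rewrite gterm_prod -ci -dj -[X in delta *+ X](subnKC (leq_ord k)) gterm_prod.
(* If [k < i], the term of [c] exceeds its minimum; if [k > i], the complementary index is below [j]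
   and the term of [d] does. *)
have [lt_ki|lt_ik|e] := ltngtP k i; last by rewrite e eqxx in k_neq_i.
  by apply: ext_ltD; rewrite ?ltc ?gauss_le_gterm ?gauss_fin.
rewrite ![_ + gterm d _]addrC [gauss c + _]addrC.
apply: ext_ltD; rewrite ?gauss_le_gterm ?gauss_fin //.
by apply: ltd; rewrite ltn_subLR ?ltn_add2r // leq_ord.
Qed.

Lemma gaussC x : gauss x%:P = v x.
Proof.
apply/eqP; rewrite eq_le; apply/andP; split.
  by have := gauss_le_gterm x%:P 0; rewrite /gterm coefC /= mulr0n addr0.
apply: gauss_ge => -[|i]; rewrite /gterm coefC /=; first by rewrite mulr0n addr0.
by rewrite val_0 lex1.
Qed.

Lemma gauss_horner_le c x : Fin delta <= v x -> gauss c <= v c.[x].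
Proof.
move=> le_x; rewrite horner_coef; apply: val_sum_ge => i _.
apply: le_trans (gauss_le_gterm c i) _; rewrite /gterm val_mul val_exp.
apply: ext_leD => //; elim: (val i) => [|n IHn] //.
by rewrite !mulrS Fin_add ext_leD.
Qed.

End GaussValuation.

(** * The valuation of the pair [(alpha, delta)], as a Gauss valuation after translation by
    [alpha] *)

Section Wbar.
Variables (L : fieldType) (G : orderedZmodType) (v : valuation L G).
Variables (alpha : L) (delta : G).
Implicit Types (g h : {poly L}) (beta : L).
Local Notation W := (wbar v alpha delta).

Lemma wbarE g : W g = gauss v delta (g \Po ('X + alpha%:P)).
Proof. by []. Qed.

Lemma wbar0 : W 0 = infty.
Proof. by rewrite wbarE comp_poly0 gauss0. Qed.

Lemma wbar_fin g : g != 0 -> W g != infty.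
Proof.
by move=> g_neq0; rewrite wbarE gauss_fin // comp_poly2_eq0 ?size_XaddC.
Qed.

Lemma wbarN g : W (- g) = W g.
Proof. by rewrite !wbarE rmorphN gaussN. Qed.

Lemma wbarD g h : Order.min (W g) (W h) <= W (g + h).
Proof. by rewrite !wbarE rmorphD gaussD. Qed.

Lemma wbarM g h : W (g * h) = W g + W h.
Proof. by rewrite !wbarE rmorphM gaussM. Qed.

Lemma wbarC x : W x%:P = v x.
Proof. by rewrite wbarE comp_polyC gaussC. Qed.

Lemma wbar_XsubC_le beta : W ('X - beta%:P) <= Fin delta.
Proof.
rewrite wbarE; apply: le_trans (gauss_le_gterm _ _ _ 1%N) _.
rewrite /gterm comp_polyB comp_polyX comp_polyC !coefE /=.
by rewrite addr0 subr0 val_1 add0r.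
Qed.

Variable theta : L.

Lemma wbar_horner_le g : Fin delta <= v (theta - alpha) -> W g <= v g.[theta].
Proof.
move=> /(gauss_horner_le (g \Po ('X + alpha%:P))).
by rewrite horner_comp !hornerE subrK.
Qed.

(** The linear term has value [delta]; the constant term is [(alpha - theta) + (theta - beta)], to
    which the ultrametric inequality applies. *)
Lemma wbar_XsubC_ge beta : Fin delta <= v (theta - alpha) ->
  v (theta - beta) <= Fin delta -> v (theta - beta) <= W ('X - beta%:P).
Proof.
move=> le_alpha le_beta; rewrite wbarE; apply: gauss_ge => i.
rewrite /gterm comp_polyB comp_polyX comp_polyC -addrA -polyCB.
case: i => [|[|i]]; rewrite !coefE /=.
- rewrite add0r mulr0n addr0 -(subrK theta alpha) -addrA.
  apply: le_trans (val_add _ _ _); rewrite le_min lexx andbT (val_subC _ alpha).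
  exact: le_trans le_beta le_alpha.
- by rewrite addr0 val_1 add0r.
- by rewrite add0r val_0 lex1.
Qed.

End Wbar.

(** * Comparison with evaluation at [theta] through the roots *)

Section WbarHorner.
Variables (L : closedFieldType) (G : orderedZmodType) (v : valuation L G).
Variables (alpha theta : L) (delta : G).
Hypothesis le_alpha : Fin delta <= v (theta - alpha).
Local Notation W := (wbar v alpha delta).

(** Both sides are multiplicative and agree on constants, which leaves the linear factors of [g],
    handled by [wbar_XsubC_ge]. *)
Lemma wbar_horner_eq (g : {poly L}) :
  (forall beta, root g beta -> v (theta - beta) <= Fin delta) ->
  W g = v g.[theta].
Proof.
move=> roots_le; apply/eqP; rewrite eq_le wbar_horner_le //=.
have [->|g_neq0] := eqVneq g 0; first by rewrite wbar0 lex1.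
have [r gE] := closed_field_poly_normal g.
have {roots_le} : {in r, forall beta, v (theta - beta) <= Fin delta}.
  move=> beta r_beta; apply: roots_le.
  by rewrite gE rootZ ?lead_coef_eq0 // root_prod_XsubC.
rewrite {}gE -mul_polyC hornerM hornerC wbarM wbarC val_mul => r_le.
apply: ext_leD => //.
elim: r r_le => [|b r IHr] r_le.
  by rewrite !big_nil hornerC wbarC.
rewrite !big_cons hornerM wbarM val_mul ext_leD //.
  by rewrite hornerXsubC wbar_XsubC_ge // r_le ?mem_head.
by apply: IHr => c rc; apply: r_le; rewrite in_cons rc orbT.
Qed.

(** The factor ['X - beta%:P] gives a strict inequality, which survives adding the weak one for the
    cofactor because the latter has finite value. *)
Lemma wbar_horner_lt (g : {poly L}) beta : g != 0 -> root g beta ->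
  Fin delta < v (theta - beta) -> W g < v g.[theta].
Proof.
move=> g_neq0 /factor_theorem [h gE] lt_beta.
have h_neq0 : h != 0 by apply: contraNneq g_neq0 => h0; rewrite gE h0 mul0r.
rewrite gE mulrC wbarM hornerM hornerXsubC val_mul.
apply: ext_ltD; rewrite ?wbar_fin ?wbar_horner_le //.
exact: le_lt_trans (wbar_XsubC_le _ _ _ _) lt_beta.
Qed.

End WbarHorner.

(** * Minimal polynomials as key polynomials *)

Section KeyPolynomialOfMinpoly.
Variables (G : orderedZmodType) (K : fieldType) (L : closedFieldType).
Variables (iota : {rmorphism K -> L}) (v : valuation L G).
Variables (theta alpha : L) (delta : G).
Hypothesis le_alpha : Fin delta <= v (theta - alpha).
Implicit Types (f g h : {poly K}).
Local Notation w := (wres iota v alpha delta).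
Local Notation "''v_' g" := (v (map_poly iota g).[theta])
  (at level 8, g at level 2).

Lemma wres_fin g : g != 0 -> w g != infty.
Proof. by move=> g_neq0; rewrite wbar_fin // map_poly_eq0. Qed.

Lemma wres0 : w 0 = infty.
Proof. by rewrite /wres rmorph0 wbar0. Qed.

Lemma wresN g : w (- g) = w g.
Proof. by rewrite /wres rmorphN wbarN. Qed.

Lemma wresD g h : Order.min (w g) (w h) <= w (g + h).
Proof. by rewrite /wres rmorphD wbarD. Qed.

Lemma wresM g h : w (g * h) = w g + w h.
Proof. by rewrite /wres rmorphM wbarM. Qed.

Lemma wres_le g : w g <= 'v_ g.
Proof. exact: wbar_horner_le. Qed.

Lemma val_hornerM g h : 'v_ (g * h) = 'v_ g + 'v_ h.
Proof. by rewrite rmorphM hornerM val_mul. Qed.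

(** If [g] is equivalent to [f * h], then [g - f * h] has value above [w g] and the same evaluation
    at [theta] as [g]. *)
Lemma wdvd_wres_lt f g : root (map_poly iota f) theta -> wdvd w f g -> w g < 'v_ g.
Proof.
move=> /rootP ftheta0 [h [lt_g _]].
apply: lt_le_trans lt_g (le_trans (wres_le _) _).
by rewrite rmorphB rmorphM !hornerE ftheta0 mul0r subr0.
Qed.

(* The polynomials [g] with [w g < 'v_ g] are those whose initial forms lie in
   a homogeneous prime ideal of the graded ring of [w]; [f] is a key polynomial
   exactly when it has least degree among them. *)
Lemma KP_minpolyP f : is_minpoly iota theta f ->
  KP w f <-> (forall g, (size g < size f)%N -> w g = 'v_ g).
Proof.
move=> [f_monic ftheta f_min]; have /rootP ftheta0 := ftheta.
have f_neq0 := monic_neq0 f_monic.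
split=> [[_ f_prime f_least] g|wE]; last first.
  (* The remainder of [g] modulo [f] is short, so its value is that of its evaluation at [theta],
     which is also that of [g], and so exceeds [w g]. *)
  have dvd_lt g : w g < 'v_ g -> wdvd w f g.
    move=> lt_g; exists (g %/ f).
    have lt_r : w g < w (g - f * (g %/ f)).
      rewrite {2}(divp_eq g f) [f * _]mulrC addrAC subrr add0r.
      rewrite [X in _ < X]wE ?ltn_modp //.
      move: lt_g; rewrite {2}(divp_eq g f) rmorphD rmorphM /= hornerD hornerM.
      by rewrite ftheta0 mulr0 add0r.
    split=> //; rewrite -[f * _](subrK g) [in RHS]addrC.
    by rewrite (ultra_addl wresN wresD) // -[X in _ < X]wresN opprB.
  split=> //.
  - move=> g h /(wdvd_wres_lt ftheta) lt_gh.
    have [lt_g|le_g] := ltP (w g) ('v_ g); first by left; apply: dvd_lt.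
    have [lt_h|le_h] := ltP (w h) ('v_ h); first by right; apply: dvd_lt.
    by move: lt_gh; rewrite wresM val_hornerM ltNge ext_leD.
  - move=> g g_neq0 /(wdvd_wres_lt ftheta) lt_g; rewrite leqNgt.
    by apply: contraTN lt_g => /wE ->; rewrite ltxx.
have [n] := ubnP (size g); elim: n g => // n IHn g; rewrite ltnS => le_gn lt_gf.
apply/eqP; rewrite eq_le wres_le /= leNgt; apply/negP => lt_g.
have g_neq0 : g != 0 by apply: contraTneq lt_g => ->; rewrite wres0 -leNgt lex1.
(* Constants satisfy the equality; [g] being nonconstant makes the quotient [f %/ g] shorter than
   [f]. *)
have size_g : (1 < size g)%N.
  rewrite ltnNge; apply: contraTN lt_g => /size1_polyC ->.
  by rewrite /wres map_polyC hornerC wbarC ltxx.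
have q_neq0 : f %/ g != 0.
  by rewrite divp_eq0 (negPf f_neq0) (negPf g_neq0) -leqNgt ltnW.
(* The induction hypothesis covers the remainder, whose evaluation at [theta] is opposite to that of
   [f %/ g * g] since [f] vanishes there. *)
have lt_r : w (f %/ g * g) < w (f %% g).
  rewrite [w (f %% g)]IHn; last 2 first.
  - by apply: leq_trans le_gn; rewrite ltn_modp.
  - by apply: leq_trans lt_gf; rewrite ltnS ltnW // ltn_modp.
  have -> : 'v_ (f %% g) = 'v_ (f %/ g * g).
    rewrite -[RHS]val_opp; congr (v _); apply/eqP; rewrite -addr_eq0 addrC.
    by rewrite -hornerD -rmorphD /= -divp_eq ftheta0.
  rewrite wresM val_hornerM addrC [X in _ < X]addrC.
  by apply: ext_ltD; rewrite ?wres_le ?wres_fin.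
have : wdvd w f (f %/ g * g).
  exists 1; rewrite mulr1; split; last first.
    by rewrite {2}(divp_eq f g) (ultra_addl wresN wresD).
  by rewrite -[X in _ < X]wresN opprB [X in X - _](divp_eq f g) addrAC subrr add0r.
move=> /f_prime [/(f_least _ q_neq0)|/(f_least _ g_neq0)]; last first.
  by rewrite leqNgt lt_gf.
rewrite size_divp // leqNgt ltn_subrL -subn1 subn_gt0 size_g.
by rewrite (leq_ltn_trans _ lt_gf).
Qed.

(** An element of degree below [n] has a minimal polynomial of size at most [n], and conversely
    roots of a nonzero polynomial of that size have degree below [n]. *)
Lemma wres_eqP n : (forall u : L, algebraicOver iota u) ->
  (forall g, (size g <= n)%N -> w g = 'v_ g) <->
  (forall beta, (deg iota beta < n)%N -> v (theta - beta) <= Fin delta).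
Proof.
move=> alg; split=> [wE beta lt_beta|le_beta g le_gn].
  have [g gP] := ex_minpoly (alg beta); have [/monic_neq0 g_neq0 gbeta _] := gP.
  rewrite leNgt; apply/negP => lt_delta.
  have : w g < 'v_ g by apply: wbar_horner_lt lt_delta; rewrite ?map_poly_eq0.
  rewrite wE ?ltxx //; move: lt_beta; rewrite (deg_minpoly gP).
  by case: (size g).
have [->|g_neq0] := eqVneq g 0; first by rewrite wres0 rmorph0 horner0 val_0.
apply: wbar_horner_eq => // beta gbeta; apply: le_beta.
exact: leq_trans (deg_root_lt (alg beta) g_neq0 gbeta) le_gn.
Qed.

End KeyPolynomialOfMinpoly.

(** * Distinguished pairs, minimal pairs and key polynomials *)

Theorem theorem5p6 (G : orderedZmodType) (K : fieldType) (v : valuation K G)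
  (Kbar : closedFieldType) (iota : {rmorphism K -> Kbar})
  (iota_alg : forall u : Kbar, algebraicOver iota u)
  (vbar : valuation Kbar G) (vbar_ext : forall x : K, vbar (iota x) = v x)
  (theta alpha : Kbar) (f phi : {poly K})
  (f_min : is_minpoly iota theta f) (phi_min : is_minpoly iota alpha phi)
  (deg_lt : (size phi < size f)%N) :
  distinguished_pair iota vbar theta alpha <->
  exists2 delta : G, vbar (theta - alpha) = Fin delta &
    minimal_pair iota vbar alpha delta /\ KP (wres iota vbar alpha delta) f.
Proof.
have [f_monic _ _] := f_min; have [phi_monic _ _] := phi_min.
have deg_alpha_lt : (deg iota alpha < deg iota theta)%N.
  rewrite (deg_minpoly f_min) (deg_minpoly phi_min).
  by rewrite -ltnS !prednK ?size_poly_gt0 ?monic_neq0.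
have size_f : size f = (deg iota theta).+1.
  by rewrite (deg_minpoly f_min) prednK // size_poly_gt0 monic_neq0.
have KP_iff delta : vbar (theta - alpha) = Fin delta ->
    KP (wres iota vbar alpha delta) f <->
    forall beta, (deg iota beta < deg iota theta)%N ->
      vbar (theta - beta) <= Fin delta.
  move=> valpha.
  have le_alpha : Fin delta <= vbar (theta - alpha) by rewrite valpha.
  have KPP := KP_minpolyP le_alpha f_min.
  have eqP' := wres_eqP le_alpha (deg iota theta) iota_alg.
  (* As [size f] is one more than the degree of [theta], the bounds [size g < size f] and
     [size g <= deg iota theta] are convertible. *)
  by rewrite size_f in KPP; apply: iff_trans KPP eqP'.
split=> [[_ [_ alpha_max] alpha_least]|[delta valpha [alpha_min fKP]]].
  case valpha : (vbar (theta - alpha)) => [delta|]; last first.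
    move/val_eq_infty: valpha => /subr0_eq e.
    by rewrite e ltnn in deg_alpha_lt.
  exists delta => //; split.
    (* An [eta] within [delta] of [alpha] is also within [delta] of [theta], so by the third
       condition its degree cannot be below that of [alpha]. *)
    move=> eta le_eta; rewrite leqNgt; apply/negP => /alpha_least.
    apply/negP; rewrite -leNgt -[theta - eta](subrKA alpha).
    apply: le_trans (val_add _ _ _); rewrite le_min lexx.
    by rewrite valpha.
  apply/(KP_iff _ valpha) => beta lt_beta; rewrite -[Fin delta]valpha.
  by apply: alpha_max; exists beta.
have /(KP_iff _ valpha) le_delta := fKP.
split=> //.
  split; first by exists alpha.
  by move=> _ [beta lt_beta <-]; rewrite valpha le_delta.
(* Conversely, an [eta] within [delta] of [theta] is within [delta] of [alpha], and the minimal pair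
   bounds its degree from below. *)
move=> eta; rewrite ltNge => lt_eta; apply/negP => le_eta.
move: lt_eta; apply/negP; rewrite -leqNgt; apply: alpha_min.
rewrite -[alpha - eta](subrKA theta); apply: le_trans (val_add _ _ _).
by rewrite le_min (val_subC _ alpha) -valpha lexx.
Qed.
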